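(* Let $m$ be a positive integer and let $B=(b_1,\dots,b_n)$ be any Ferrers board. Then $$ \sum_{k=0}^n p^{xk+m\binom{k+1}{2}}\ r_{k,m}[B]\ [x]\downarrow_{n-k,m} = \prod_{j=1}^n \begin{cases} q^{\rho_m(z)}[x+\lfloor b_j \rfloor_m -(j-1)m] + \sum\limits_{i\in z} p^{x+\lfloor b_i \rfloor_m -(i-1)m}q^{\rho_{i-1,m}(z)}[\rho_m(b_i)] &\text{if $j$ is last in its $m$-zone $z$,}\\[6pt] [x+\lfloor b_j \rfloor_m -(j-1)m] &\text{otherwise.} \end{cases} $$
   Context: Cells of the first quadrant have coordinates $(i,j)$ = (column, row) of their northeast corner. A Ferrers board $B=(b_1,\dots,b_n)$ ($0\le b_1\le\dots\le b_n$ integers) consists of the $b_j$ lowest cells of column $j$. Fix a positive integer $m$; the $i$th level consists of rows $(i-1)m+1,\dots,im$. An $m$-level rook placement $P\subseteq B$ has no two cells (rooks) in the same level or the same column. For $(i,j)\in B$, its $m$-coleg is the set of cells $(i',j')\in B$ with $i'>i$ and rows $j,j'$ in the same level. For a placement $P$: $\alpha_m(P)$ is the number of cells of $B$ lying above a rook of $P$ in its column and not in the $m$-coleg of any rook of $P$; $\beta_m(P)$ is the number of cells of $B$ lying below a rook of $P$ in its column and not in the $m$-coleg of any rook of $P$; $\epsilon_m(P)$ is the number of cells of $B$ in a column containing no rook of $P$ and not in the $m$-coleg of any rook of $P$. Define $r_{k,m}[B]=\sum_P p^{\beta_m(P)-(c_1+\dots+c_k)m} q^{\alpha_m(P)+\epsilon_m(P)}$,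 summed over $m$-level rook placements $P\subseteq B$ with $k$ rooks, where $c_1<\dots<c_k$ are the indices of the columns containing the rooks. For any $x$, $[x]=[x]_{p,q}=\frac{p^x-q^x}{p-q}$, and $[x]\downarrow_{n,m}=[x][x-m]\cdots[x-(n-1)m]$ (equal to $1$ if $n=0$). For an integer $n$, $\lfloor n\rfloor_m$ is the largest multiple of $m$ that is $\le n$ and $\rho_m(n)=n-\lfloor n\rfloor_m$. An $m$-zone of $B$ is a maximal interval $z=[s,t]$ of column indices with $\lfloor b_s\rfloor_m=\dots=\lfloor b_t\rfloor_m$; $\rho_m(z)=\sum_{j\in z}\rho_m(b_j)$, and for $i\in z$ or $i=s-1$, $\rho_{i,m}(z)=\sum_{s\le j\le i}\rho_m(b_j)$ (so $\rho_{s-1,m}(z)=0$). *)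

(* Defs.v *)
From HB Require Import structures.
From mathcomp Require Import all_boot all_order all_algebra.
From mathcomp Require Import reals.
From mathcomp Require exp.

Set Implicit Arguments.
Unset Strict Implicit.
Unset Printing Implicit Defensive.

Import Order.TTheory GRing.Theory Num.Theory.

(* A Ferrers board is a weakly increasing [b : 'I_n -> nat]. Columns and rows
   are numbered from 0: the column indexed by [j : 'I_n] is column [j.+1] of
   the quadrant, and row [r : 'I_(b j)] is row [r.+1].                       *)

Section Board.
Variables (m n : nat) (b : 'I_n -> nat).

Definition ferrers : Prop := {homo b : i j / (i <= j)%N}.

Definition cell := {j : 'I_n & 'I_(b j)}.

Definition col (c : cell) : 'I_n := tag c.
Definition row (c : cell) : nat := tagged c.
Definition level (c : cell) : nat := row c %/ m.

Definition rook_placement (P : {set cell}) : bool :=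
  [forall c in P, forall d in P,
     (c != d) ==> (level c != level d) && (col c != col d)].

(* The m-coleg of [c]. *)
Definition coleg (c : cell) : {set cell} :=
  [set d | (col c < col d)%N && (level c == level d)].

Definition in_coleg (P : {set cell}) (d : cell) : bool :=
  [exists c in P, d \in coleg c].

Definition alpha (P : {set cell}) : nat :=
  #|[set d | [exists c in P, (col d == col c) && (row c < row d)%N]
             && ~~ in_coleg P d]|.

Definition beta (P : {set cell}) : nat :=
  #|[set d | [exists c in P, (col d == col c) && (row d < row c)%N]
             && ~~ in_coleg P d]|.

Definition epsilon (P : {set cell}) : nat :=
  #|[set d | ~~ [exists c in P, col d == col c] && ~~ in_coleg P d]|.

(* c_1 + ... + c_k: the columns are distinct, so one may sum over the rooks. *)
Definition colsum (P : {set cell}) : nat := \sum_(c in P) (col c).+1.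

Definition rook_number (F : fieldType) (p q : F) (k : nat) : F :=
  (\sum_(P : {set cell} | rook_placement P && (#|P| == k))
     p ^ ((beta P)%:Z - (colsum P * m)%:Z) * q ^+ (alpha P + epsilon P))%R.

Definition floorm (a : nat) : nat := a %/ m * m.
Definition rhom (a : nat) : nat := a - floorm a.

Definition is_interval (z : {set 'I_n}) : bool :=
  [forall i in z, forall j in z, forall l : 'I_n,
     (i <= l <= j)%N ==> (l \in z)].

Definition floor_constant (z : {set 'I_n}) : bool :=
  [forall i in z, forall j in z, floorm (b i) == floorm (b j)].

Definition mzones : {set {set 'I_n}} :=
  [set z | maxset (fun y => is_interval y && floor_constant y) z].

(* The m-zone containing column [j]. *)
Definition mzone (j : 'I_n) : {set 'I_n} := pblock mzones j.

Definition zone_rho (z : {set 'I_n}) : nat := \sum_(l in z) rhom (b l).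

(* [i] is here an index counted from 1, as in rho_{i,m}(z). *)
Definition zone_rho_upto (i : nat) (z : {set 'I_n}) : nat :=
  \sum_(l in z | (l.+1 <= i)%N) rhom (b l).

Definition last_in_zone (j : 'I_n) : bool := [forall i in mzone j, (i <= j)%N].

End Board.

Local Open Scope ring_scope.

(* [is_power p e]: [e x] may be written p^x, for exponents [x] in a ring [E]
   (whose elements [k%:R] are the integer exponents). The identity is about
   arbitrary exponents x, so that x may be an integer, a real number or an
   indeterminate; the lemmas below cover these three cases.                  *)
Definition is_power (E : pzRingType) (F : fieldType) (p : F) (e : E -> F) :
  Prop := e 1 = p /\ (forall x y, e (x + y) = e x * e y).

Lemma is_power_int (F : fieldType) (p : F) :
  p != 0 -> is_power p (fun x : int => p ^ x).
Proof. by move=> p0; split=> [|x y]; [exact: expr1z | exact: expfzDr]. Qed.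

Lemma is_power_real (R : realType) (p : R) :
  0 < p -> is_power p (fun x : R => exp.powR p x).
Proof.
move=> p0; split=> [|x y]; first by rewrite exp.powRr1 // ltW.
by rewrite exp.powRD // (gt_eqF p0) implybT.
Qed.

(* Exponents u + v x with [x] formal and p^x := [t], for instance with [p] and
   [t] independent indeterminates.                                           *)
Lemma is_power_formal (F : fieldType) (p t : F) : p != 0 -> t != 0 ->
  is_power p (fun x : {poly int} => p ^ x`_0 * t ^ x`_1).
Proof.
move=> p0 t0; split=> [|x y]; first by rewrite !coefC /= expr1z expr0z mulr1.
by rewrite !coefD !expfzDr // mulrACA.
Qed.

Section Bracket.
Variables (E : pzRingType) (F : fieldType) (p q : F) (pw qw : E -> F).

(* [x]_{p,q}, where [pw x] and [qw x] stand for p^x and q^x. *)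
Definition bracket (x : E) : F := (pw x - qw x) / (p - q).

(* [x] \downarrow_{k,m} *)
Definition falling (m k : nat) (x : E) : F :=
  \prod_(i < k) bracket (x - (i * m)%:R).

End Bracket.

(* Main.v *)
(* Build placements column by column, weighting a placement with k rooks in the
   first j columns by p^(xk + m C(k+1,2)) [x] \downarrow_(j-k,m). Whatever the
   placement, adding a column with f cells in full levels and rho cells in a
   partial level multiplies the total weight by a bracket that no longer depends
   on k; only whether the partial level already contains a rook matters. Within a
   zone there are thus two sums, A (partial level free) and O (occupied):
     A_j = q^rho [x + f - (j-1)m] A_(j-1),
     O_j = p^(x+f-(j-1)m) [rho] A_(j-1) + [x + f - (j-2)m] O_(j-1),
   and A + O at the end of a zone becomes the A of the next zone, whose partial
   level lies above all the rooks placed so far. *)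
Require Import Defs.
From mathcomp Require Import all_boot all_order all_algebra.
From mathcomp Require Import ring zify.

Set Implicit Arguments.
Unset Strict Implicit.
Unset Printing Implicit Defensive.

Import GRing.Theory.
Local Open Scope ring_scope.

(* [row] and [col] would otherwise be those of matrices. *)
Local Notation row := Defs.row.
Local Notation col := Defs.col.

Lemma exists_in_setU1 (T : finType) (c : T) (A : {set T}) (P : pred T) :
  [exists x in c |: A, P x] = P c || [exists x in A, P x].
Proof.
apply/existsP/orP => [[x /andP[]]|[Pc|/existsP[x /andP[xA Px]]]].
- rewrite !inE => /orP[/eqP->|xA] Px; first by left.
  by right; apply/existsP; exists x; rewrite xA.
- by exists c; rewrite !inE eqxx.
- by exists x; rewrite !inE xA orbT.
Qed.

(** * Powers with exponents in the ring [E] *)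

Section Powers.
Variables (E : pzRingType) (F : fieldType) (p : F) (e : E -> F).
Hypotheses (p_neq0 : p != 0) (he : is_power p e).

Lemma is_powerD x y : e (x + y) = e x * e y.
Proof. exact: he.2. Qed.

(** Cancel the nonzero [p = e 1] in [e 1 = e 1 * e 0]. *)
Lemma is_power0 : e 0 = 1.
Proof.
have e1 : e 1 = e 1 * e 0 by rewrite -is_powerD addr0.
by apply: (mulfI p_neq0); rewrite mulr1 -he.1 -e1.
Qed.

Lemma is_powerMn x k : e (x *+ k) = e x ^+ k.
Proof.
by elim: k => [|k IHk]; rewrite ?mulr0n ?is_power0 // mulrS is_powerD IHk exprS.
Qed.

Lemma is_power_nat k : e k%:R = p ^+ k.
Proof. by rewrite is_powerMn he.1. Qed.

Lemma is_powerBn x k : e (x - k%:R) = e x / p ^+ k.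
Proof.
have pk0 : p ^+ k != 0 by rewrite expf_neq0.
by apply: (mulIf pk0); rewrite -{1}is_power_nat -is_powerD subrK mulfVK.
Qed.

End Powers.

(** * Generating function for the position of one rook in a column *)

Section FreeCells.
Variables (F : fieldType) (p q : F) (a : pred nat).

Definition free_count (k : nat) : nat := (\sum_(r < k) a r)%N.

(** The predicate [a] will single out the rows outside the colegs of earlier rooks; [r] is the row
    of the rook and [s] that of the cell being weighed. The rook's own cell counts neither for alpha
    nor for beta, hence weight 1. *)
Definition split_wt (r s : nat) : F :=
  if a s then if (s < r)%N then p else if (r < s)%N then q else 1 else 1.

Lemma free_countS k : free_count k.+1 = (free_count k + a k)%N.
Proof. by rewrite /free_count big_ord_recr. Qed.

Lemma leq_free_count h k : (h <= k)%N -> (free_count h <= free_count k)%N.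
Proof.
move/subnKC <-; elim: (k - h)%N => [|d IHd]; first by rewrite addn0.
by rewrite addnS free_countS (leq_trans IHd) ?leq_addr.
Qed.

Lemma prod_free (v : F) k :
  \prod_(r < k) (if a r then v else 1) = v ^+ free_count k.
Proof.
elim: k => [|k IHk]; first by rewrite /free_count !big_ord0.
by rewrite big_ord_recr /= IHk free_countS exprD; case: (a k).
Qed.

Lemma prod_split_wt k : \prod_(s < k) split_wt k s = p ^+ free_count k.
Proof. by rewrite -prod_free; apply: eq_bigr => s _; rewrite /split_wt ltn_ord. Qed.

(** With N free rows in all, a rook that has i of them below it gives p^i q^(N-1-i), so the sum is
    geometric. The free rows from [h] up always lie above the rook and contribute a constant power
    of q. *)
Lemma sum_split_wt h k : (h <= k)%N ->
  (p - q) * \sum_(r < k | a r && (r < h)%N) \prod_(s < k) split_wt r s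
  = (p ^+ free_count h - q ^+ free_count h) * q ^+ (free_count k - free_count h).
Proof.
(* Adding a top row [k']: it lies above every rook placed lower, and a rook in it has all the other
   free rows below. *)
have recr k' c : \sum_(r < k'.+1 | a r && (r < c)%N) \prod_(s < k'.+1) split_wt r s
    = (\sum_(r < k' | a r && (r < c)%N) \prod_(s < k') split_wt r s)
        * (if a k' then q else 1)
      + (if a k' && (k' < c)%N then p ^+ free_count k' else 0).
  rewrite big_mkcond big_ord_recr /= -big_mkcond /=; congr (_ + _).
    rewrite mulr_suml; apply: eq_bigr => r _; rewrite big_ord_recr /=.
    by rewrite /split_wt ltn_ord ltnNge ltnW.
  by case: ifP => // _; rewrite big_ord_recr /= prod_split_wt {1}/split_wt ltnn; case: ifP; rewrite mulr1.
(* The case where the bound on the rook's row is vacuous; the rows from [h] up are added afterwards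
   by induction. *)
have full k' c : (k' <= c)%N ->
    (p - q) * \sum_(r < k' | a r && (r < c)%N) \prod_(s < k') split_wt r s
    = p ^+ free_count k' - q ^+ free_count k'.
  elim: k' => [|k' IHk] kc; first by rewrite /free_count !big_ord0 subrr mulr0.
  rewrite recr mulrDr mulrA (IHk (ltnW kc)) kc andbT free_countS !exprD.
  by case: (a k'); rewrite /= ?expr0 ?expr1; ring.
move/subnKC <-; elim: (k - h)%N => [|d IHd].
  by rewrite addn0 subnn mulr1 full.
rewrite addnS recr mulrDr mulrA IHd [X in _ && X]ltnNge leq_addr andbF mulr0 addr0.
rewrite free_countS -mulrA -addnBAC ?leq_free_count ?leq_addr // exprD.
by case: (a _).
Qed.

End FreeCells.

(** * Rook placements, column by column *)

Section Placements.
Variables (m n : nat) (b : 'I_n -> nat).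
Implicit Types (P Q : {set cell b}) (c d : cell b).

Definition occupied Q (l : nat) : bool := [exists c in Q, level m c == l].

Definition cols_below (k : nat) Q : bool := [forall c in Q, (col c < k)%N].

Lemma cols_belowP k Q :
  reflect {in Q, forall c, (col c < k)%N} (cols_below k Q).
Proof. exact: 'forall_in_idP. Qed.

Lemma placementP P : reflect
  {in P &, forall c d, c != d -> level m c != level m d /\ col c != col d}
  (rook_placement m P).
Proof.
apply: (iffP 'forall_in_'forall_in_implyP) => H c.
  by move=> d cP dP /(H _ cP _ dP)/andP.
by move=> cP d dP /(H _ _ cP dP)[-> ->].
Qed.

Lemma big_col (R : Type) (idx : R) (op : Monoid.com_law idx) (j : 'I_n)
    (f : nat -> R) (g : pred nat) :
  \big[op/idx]_(c : cell b | (col c == j) && g (row c)) f (row c)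
  = \big[op/idx]_(r < b j | g r) f r.
Proof.
rewrite /col /row /cell.
rewrite -(sig_big_dep (fun i => i == j) (fun i (r : 'I_(b i)) => g r)
            (fun i (r : 'I_(b i)) => f r)).
by rewrite big_pred1_eq.
Qed.

Lemma occupiedU c Q l : occupied (c |: Q) l = (level m c == l) || occupied Q l.
Proof. exact: exists_in_setU1. Qed.

Lemma notin_cols_below (j : 'I_n) c Q : cols_below j Q -> col c = j -> c \notin Q.
Proof.
by move=> /cols_belowP Qj cj; apply/negP => /Qj; rewrite cj ltnn.
Qed.

(** The rooks of [Q] stand in columns before [j], so a new rook in column [j] can only conflict with
    them through its level. *)
Lemma placementU (j : 'I_n) c Q : cols_below j Q -> col c = j ->
  rook_placement m (c |: Q) = rook_placement m Q && ~~ occupied Q (level m c).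
Proof.
move=> Qj cj; have cQ := notin_cols_below Qj cj; move/cols_belowP: Qj => Qj.
apply/placementP/andP => [H|[/placementP H /existsP H']].
  split.
    by apply/placementP => d e dQ eQ; apply: H; rewrite !inE ?dQ ?eQ orbT.
  apply/negP => /existsP[d /andP[dQ /eqP dc]].
  have /H : d \in c |: Q by rewrite !inE dQ orbT.
  move=> /(_ c); rewrite setU11 => /(_ isT); rewrite dc eqxx => -[] //.
  by apply: contraNneq cQ => <-.
have aux d : d \in Q -> level m c != level m d /\ col c != col d.
  move=> dQ; split.
    by apply/eqP => cd; case: H'; exists d; rewrite dQ cd eqxx.
  by apply/eqP => cd; have := Qj _ dQ; rewrite -cd cj ltnn.
move=> d e; rewrite !inE => /orP[/eqP->|dQ] /orP[/eqP->|eQ]; first by rewrite eqxx.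
- by move=> _; apply: aux.
- by move=> _; rewrite eq_sym (eq_sym (col d)); apply: aux.
- exact: H.
Qed.

Lemma cols_belowU (j : 'I_n) c Q : col c = j -> c \notin Q ->
  rook_placement m (c |: Q) -> cols_below j.+1 (c |: Q) = cols_below j Q.
Proof.
move=> cj cQ /placementP H; apply/cols_belowP/cols_belowP => Qj d.
  move=> dQ; have dcQ : d \in c |: Q by rewrite !inE dQ orbT.
  have /(_ (setU11 _ _)) := H d c dcQ.
  have dc : d != c by apply: contraNneq cQ => <-.
  move=> /(_ dc)[_]; rewrite cj => djN; rewrite ltn_neqAle.
  by have := Qj _ dcQ; rewrite ltnS => ->; rewrite andbT.
by rewrite !inE => /orP[/eqP->|/Qj/ltnW]; rewrite ?cj.
Qed.

Lemma cols_belowS (j : nat) Q : cols_below j Q -> cols_below j.+1 Q.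
Proof. by move=> /cols_belowP Qj; apply/cols_belowP => c /Qj/ltnW. Qed.

(** A placement has at most one rook in column [j]; removing it, if present, leaves a placement in
    the earlier columns. *)
Lemma big_placement_recr (V : nmodType) (G : {set cell b} -> V) (j : 'I_n) :
  \sum_(P | rook_placement m P && cols_below j.+1 P) G P
  = \sum_(Q | rook_placement m Q && cols_below j Q)
      (G Q + \sum_(c | (col c == j) && ~~ occupied Q (level m c)) G (c |: Q)).
Proof.
rewrite (bigID (fun P => [exists c in P, col c == j])) /= addrC big_split /=.
congr (_ + _).
  apply: eq_bigl => P; rewrite -andbA; congr (_ && _).
  apply/andP/idP => [[/cols_belowP Pj] |Pj].
    move=> /existsPn Pj'; apply/cols_belowP => c cP.
    have := Pj' c; rewrite cP /= => cj; have := Pj _ cP.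
    by rewrite ltnS leq_eqVlt val_eqE (negPf cj).
  split; first exact: cols_belowS.
  apply/negP => /existsP[c /andP[cP /eqP cj]].
  by have := notin_cols_below Pj cj; rewrite cP.
(* [H P] holds for exactly one cell if column [j] has a rook and for none otherwise, so summing over
   it makes the rook a summation variable, which can be exchanged with the placement. *)
pose H P c := (c \in P) && (col c == j).
have -> : \sum_(P | rook_placement m P && cols_below j.+1 P
                    && [exists c in P, col c == j]) G P
    = \sum_(P | rook_placement m P && cols_below j.+1 P) \sum_(c | H P c) G P.
  rewrite [LHS]big_mkcondr; apply: eq_bigr => P /andP[/placementP pP _].
  case: existsP => [[c cP]|Pj]; last first.
    by rewrite big_pred0 // => c; apply/negP => cP; apply: Pj; exists c.
  rewrite (big_pred1 c) // => d; apply/idP/eqP => [dP|-> //].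
  apply/eqP; apply: contraT => dc.
  move: dP cP => /andP[dP /eqP dj] /andP[cP /eqP cj].
  by have [_] := pP _ _ dP cP dc; rewrite dj cj eqxx.
rewrite (exchange_big_dep (fun c => col c == j)) /=; last by move=> P c _ /andP[].
rewrite [RHS](exchange_big_dep (fun c => col c == j)) /=; last by move=> P c _ /andP[].
apply: eq_bigr => c /eqP cj.
rewrite (reindex_onto (fun Q => c |: Q) (fun P => P :\ c)) /=; last first.
  by move=> P /andP[_ /andP[cP _]]; rewrite setD1K.
apply: eq_bigl => Q; rewrite /H setU11 cj eqxx !andbT /=.
have -> : ((c |: Q) :\ c == Q) = (c \notin Q).
  apply/eqP/idP => [<-|cQ]; first by rewrite !inE eqxx.
  by rewrite setU1K.
apply/andP/andP => [[/andP[pP Pj] cQ]|[/andP[pQ Qj] occ]].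
  have Qj : cols_below j Q by rewrite -(cols_belowU cj cQ pP).
  by move: pP; rewrite (placementU Qj cj) => /andP[-> ->].
have cQ := notin_cols_below Qj cj.
have pP : rook_placement m (c |: Q) by rewrite (placementU Qj cj) pQ.
by rewrite pP (cols_belowU cj cQ pP).
Qed.

(** Distinct rooks have distinct levels, so counting occupied levels counts rooks. Level [L] is
    split off because it will be the partial level of a column. *)
Lemma sum_occupied Q L : rook_placement m Q ->
  {in Q, forall c, (level m c <= L)%N} ->
  (\sum_(l < L) occupied Q l + occupied Q L = #|Q|)%N.
Proof.
move=> /placementP pQ QL.
rewrite -(big_ord_recr L (fun l => occupied Q l : nat)) /=.
have E (l : 'I_L.+1) : (occupied Q l : nat) = (\sum_(c in Q) (level m c == l))%N.
  rewrite /occupied; case: existsP => [[c /andP[cQ /eqP cl]]|Ql].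
    rewrite (bigD1 c) //= cl eqxx big1 // => d /andP[dQ dc].
    by have [+ _] := pQ _ _ dQ cQ dc; rewrite cl => /negPf->.
  rewrite big1 // => c cQ; case: eqP => // cl.
  by case: Ql; exists c; rewrite cQ cl eqxx.
rewrite (eq_bigr _ (fun l _ => E l)) exchange_big /= -sum1_card.
apply: eq_bigr => c cQ; rewrite (bigD1 (inord (level m c))) //=.
have cL : (level m c < L.+1)%N by rewrite ltnS QL.
rewrite inordK // eqxx big1 // => l.
by case: (level m c =P l) => // lc /eqP[]; apply: val_inj; rewrite /= lc inordK -?lc.
Qed.

Lemma card_cols_below Q k :
  rook_placement m Q -> cols_below k Q -> (#|Q| <= k)%N.
Proof.
move=> /placementP pQ /cols_belowP Qk.
rewrite cardE -(size_map (fun c => col c : nat)) -[leqRHS](size_iota 0).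
apply: uniq_leq_size => [|i /mapP[c]]; last first.
  by rewrite mem_enum mem_iota => /Qk ? ->.
rewrite map_inj_in_uniq ?enum_uniq // => c d; rewrite !mem_enum => cQ dQ /val_inj cd.
apply/eqP; apply: contraT => /(pQ _ _ cQ dQ)[_].
by rewrite cd eqxx.
Qed.

(** For a cell to the right of all rooks of [Q], lying in a coleg depends on its row alone. *)
Definition free Q : pred nat := fun r => ~~ occupied Q (r %/ m).

(** A level is free or lost as a whole. The value [d = m] is allowed so that full levels are covered
    too. *)
Lemma free_count_partial Q (L d : nat) : (d <= m)%N -> (0 < m)%N ->
  free_count (free Q) (L * m + d)
  = (free_count (free Q) (L * m) + ~~ occupied Q L * d)%N.
Proof.
move=> + m_gt0; elim: d => [|d IHd] dm; first by rewrite addn0 muln0 addn0.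
rewrite addnS free_countS (IHd (ltnW dm)) /free divnMDl // divn_small // addn0.
by rewrite mulnS addnA addnAC.
Qed.

Lemma free_count_levels Q L : (0 < m)%N ->
  (free_count (free Q) (L * m) + (\sum_(l < L) occupied Q l) * m = L * m)%N.
Proof.
move=> m_gt0; elim: L => [|L IHL]; first by rewrite /free_count !big_ord0.
rewrite big_ord_recr /= mulSnr free_count_partial //.
by case: (occupied Q L); move: IHL; rewrite /= mulnDl ?mul0n ?mul1n; lia.
Qed.

End Placements.

(** * Brackets, and the weight of a placement as a product over cells *)

Section Weights.
Variables (F : fieldType) (E : pzRingType) (p q : F) (pw qw : E -> F).
Hypotheses (p_neq0 : p != 0) (q_neq0 : q != 0) (p_neq_q : p != q).
Hypotheses (hpw : is_power p pw) (hqw : is_power q qw).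
Variables (m n : nat) (m_gt0 : (0 < m)%N) (b : 'I_n -> nat) (b_ferrers : ferrers b).
Variable x : E.
Implicit Types (P Q : {set cell b}) (c d : cell b).

Let pq_neq0 : p - q != 0. Proof. by rewrite subr_eq0. Qed.
Let pX_neq0 k : p ^+ k != 0. Proof. exact: expf_neq0. Qed.
Let qX_neq0 k : q ^+ k != 0. Proof. exact: expf_neq0. Qed.

Local Notation "[ x ]" := (bracket p q pw qw x) (format "[ x ]").

Lemma bracketDBn y u v :
  [y + u%:R - v%:R] = (pw y * p ^+ u / p ^+ v - qw y * q ^+ u / q ^+ v) / (p - q).
Proof.
by rewrite /bracket !(is_powerBn p_neq0 hpw, is_powerBn q_neq0 hqw)
  !(is_powerD hpw, is_powerD hqw) (is_power_nat p_neq0 hpw) (is_power_nat q_neq0 hqw).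
Qed.

Lemma bracketBn y v : [y - v%:R] = (pw y / p ^+ v - qw y / q ^+ v) / (p - q).
Proof. by have := bracketDBn y 0 v; rewrite addr0 !mulr1. Qed.

Lemma bracket_nat u : [u%:R] = (p ^+ u - q ^+ u) / (p - q).
Proof.
by rewrite /bracket (is_power_nat p_neq0 hpw) (is_power_nat q_neq0 hqw).
Qed.

(** The three factors are the contributions of the cell to beta, alpha and epsilon. *)
Definition cell_wt P d : F :=
  (if [exists c in P, (col d == col c) && (row d < row c)%N]
      && ~~ in_coleg m P d then p else 1)
  * (if [exists c in P, (col d == col c) && (row c < row d)%N]
      && ~~ in_coleg m P d then q else 1)
  * (if ~~ [exists c in P, col d == col c] && ~~ in_coleg m P d then q else 1).

Lemma prod_cell_wt P :
  \prod_d cell_wt P d = p ^+ beta m P * q ^+ (alpha m P + epsilon m P).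
Proof.
rewrite !big_split /= -!big_mkcond /= exprD mulrA.
by congr (_ * _ * _); rewrite -prodr_const; apply: eq_bigl => d; rewrite inE.
Qed.

Lemma in_coleg_below (j : 'I_n) Q d : cols_below j Q -> col d = j ->
  in_coleg m Q d = occupied m Q (level m d).
Proof.
move=> /cols_belowP Qj dj; apply: eq_existsb => c.
by rewrite inE dj; case: (boolP (c \in Q)) => //= /Qj ->.
Qed.

Lemma col_below_absent (j : 'I_n) Q d (R : rel nat) : cols_below j Q -> col d = j ->
  [exists c in Q, (col d == col c) && R (row d) (row c)] = false.
Proof.
move=> /cols_belowP Qj dj; apply/existsP => -[c /andP[/Qj cj]].
by rewrite dj => /andP[/eqP jc]; rewrite -jc ltnn in cj.
Qed.

Lemma cell_wt_empty_col (j : 'I_n) Q d : cols_below j Q -> col d = j ->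
  cell_wt Q d = if free m Q (row d) then q else 1.
Proof.
move=> Qj dj; rewrite /cell_wt (in_coleg_below Qj dj).
rewrite (col_below_absent ltn Qj dj) (col_below_absent (fun r s => s < r)%N Qj dj).
have := col_below_absent (fun _ _ => true) Qj dj.
under eq_existsb do rewrite andbT.
by move=> ->; rewrite /= !mul1r.
Qed.

Lemma cell_wt_rook_col (j : 'I_n) Q c d :
  cols_below j Q -> col c = j -> col d = j ->
  cell_wt (c |: Q) d = split_wt p q (free m Q) (row c) (row d).
Proof.
move=> Qj cj dj; rewrite /cell_wt /in_coleg !exists_in_setU1.
rewrite -/(in_coleg m Q d) (in_coleg_below Qj dj).
rewrite (col_below_absent ltn Qj dj) (col_below_absent (fun r s => s < r)%N Qj dj).
rewrite inE dj cj eqxx ltnn /= !orbF /split_wt /free -/(level m d).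
by case: (occupied m Q _); case: (ltngtP (row c) (row d)); rewrite /= ?mulr1 ?mul1r.
Qed.

(** Colegs extend only to the right, so a later rook does not disturb the weights of the earlier
    columns. *)
Lemma cell_wtU Q c d : (col d < col c)%N -> cell_wt (c |: Q) d = cell_wt Q d.
Proof.
move=> dc; rewrite /cell_wt /in_coleg !exists_in_setU1.
have -> : (col d == col c) = false by apply/eqP => dc'; rewrite dc' ltnn in dc.
by rewrite inE [(col c < _)%N]ltnNge (ltnW dc).
Qed.

(** For [Q] in the first [k] columns, its term on the left side of the theorem for the board cut
    down to these columns. *)
Definition weight (k : nat) Q : F :=
  (\prod_(d : cell b | (col d < k)%N) cell_wt Q d) / p ^+ (colsum Q * m)
  * pw x ^+ #|Q| * p ^+ (m * 'C(#|Q|.+1, 2))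
  * falling p q pw qw m (k - #|Q|) x.

Lemma big_col_ltS (j : 'I_n) (f : cell b -> F) :
  \prod_(d : cell b | (col d < j.+1)%N) f d
  = (\prod_(d : cell b | (col d < j)%N) f d)
    * \prod_(d : cell b | (col d == j) && true) f d.
Proof.
rewrite (bigID (fun d : cell b => (col d < j)%N)) /=; congr (_ * _); apply: eq_bigl => d.
  by apply/andP/idP => [[]//|dj]; rewrite ltnS ltnW.
by rewrite ltnS -leqNgt -eqn_leq val_eqE andbT.
Qed.

Lemma weight_empty_col (j : 'I_n) Q : rook_placement m Q -> cols_below j Q ->
  weight j.+1 Q = weight j Q
    * (q ^+ free_count (free m Q) (b j) * [x - ((j - #|Q|) * m)%:R]).
Proof.
move=> pQ Qj; rewrite /weight big_col_ltS (subSn (card_cols_below pQ Qj)).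
rewrite [falling _ _ _ _ _ _.+1 _]big_ord_recr /= -/(falling p q pw qw m _ x).
rewrite [\prod_(d | (col d == j) && _) _](eq_bigr (fun d => if free m Q (row d) then q else 1)); last first.
  by move=> d /andP[/eqP dj _]; apply: cell_wt_empty_col dj.
rewrite (big_col b *%R j (fun r => if free m Q r then q else 1) predT).
by rewrite prod_free; ring.
Qed.

(** The falling product is unchanged, since both [j] and the number of rooks grow by one. The
    binomial gains [#|Q|.+1] and the column sum gains [j.+1], which leaves the power
    [(#|Q| - j) * m] of p. *)
Lemma weight_rook_col (j : 'I_n) Q c : rook_placement m Q -> cols_below j Q ->
  col c = j ->
  weight j.+1 (c |: Q) = weight j Q
    * (pw x * p ^+ (#|Q| * m) / p ^+ (j * m)
       * \prod_(s < b j) split_wt p q (free m Q) (row c) s).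
Proof.
move=> pQ Qj cj; have cQ := notin_cols_below Qj cj.
rewrite /weight big_col_ltS cardsU1 cQ /= add1n subSS.
rewrite [\prod_(d : cell b | (col d < j)%N) _](eq_bigr (cell_wt Q)); last first.
  by move=> d dj; apply: cell_wtU; rewrite cj.
rewrite [\prod_(d | (col d == j) && _) _](eq_bigr (fun d => split_wt p q (free m Q) (row c) (row d))); last first.
  by move=> d /andP[/eqP dj _]; apply: (cell_wt_rook_col Qj).
rewrite (big_col b *%R j (split_wt p q (free m Q) (row c)) predT).
have -> : colsum (c |: Q) = (colsum Q + j.+1)%N.
  by rewrite /colsum big_setU1 //= cj addnC.
rewrite (binS _.+1) bin1 mulnDr mulnDl mulSn mulnS (mulnC m #|Q|) !exprD exprS.
by field; rewrite !pX_neq0.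
Qed.

(** The cutoff [h] will be either the height of the full levels or that of the whole column. *)
Lemma sum_weight_rook_col (j : 'I_n) Q h :
  rook_placement m Q -> cols_below j Q -> (h <= b j)%N ->
  \sum_(c | (col c == j) && (free m Q (row c) && (row c < h)%N)) weight j.+1 (c |: Q)
  = weight j Q * (pw x * p ^+ (#|Q| * m) / p ^+ (j * m)
      * (p ^+ free_count (free m Q) h - q ^+ free_count (free m Q) h)
      * q ^+ (free_count (free m Q) (b j) - free_count (free m Q) h) / (p - q)).
Proof.
move=> pQ Qj hb.
rewrite (eq_bigr (fun c => weight j Q
    * (pw x * p ^+ (#|Q| * m) / p ^+ (j * m)
       * \prod_(s < b j) split_wt p q (free m Q) (row c) s))); last first.
  by move=> c /andP[/eqP cj _]; apply: weight_rook_col.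
rewrite -!mulr_sumr (big_col b +%R j
  (fun r => \prod_(s < b j) split_wt p q (free m Q) r s)
  (fun r => free m Q r && (r < h)%N)).
rewrite -!(mulrA (pw x)) -!(mulrA (p ^+ _)) -!(mulrA (p ^- _)); congr (_ * (_ * (_ * (_ * _)))).
apply: (mulfI pq_neq0); rewrite [LHS]sum_split_wt //.
by field.
Qed.

(** * The factor contributed by one more column *)

Lemma level_cols_below (j : 'I_n) Q : cols_below j.+1 Q ->
  {in Q, forall c, (level m c <= b j %/ m)%N}.
Proof.
move=> /cols_belowP Qj c /Qj; rewrite ltnS => cj.
by apply: leq_div2r; apply: leq_trans (b_ferrers cj); apply: ltnW; exact: ltn_ord.
Qed.

Lemma floorm_rhomE k : k = (floorm m k + rhom m k)%N.
Proof. by rewrite subnKC // leq_divM. Qed.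

Lemma rhom_lt k : (rhom m k < m)%N.
Proof. by rewrite /rhom /floorm {1}(divn_eq k m) addKn ltn_pmod. Qed.

(** As the board is Ferrers, the rooks of [Q] lie in levels up to [L]. Each one below level [L]
    costs column [j] exactly m rows of its full levels; a rook in level [L] costs none of these,
    whence the correction. Sums replace differences to avoid truncated subtraction. *)
Lemma free_counts (j : 'I_n) Q (L := (b j %/ m)%N) :
  rook_placement m Q -> cols_below j Q ->
  (free_count (free m Q) (floorm m (b j)) + #|Q| * m
     = floorm m (b j) + occupied m Q L * m)%N
  /\ (free_count (free m Q) (b j)
     = free_count (free m Q) (floorm m (b j)) + ~~ occupied m Q L * rhom m (b j))%N.
Proof.
move=> pQ Qj; split; last first.
  by rewrite {1}(floorm_rhomE (b j)) free_count_partial // ltnW // rhom_lt.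
rewrite -(sum_occupied pQ (level_cols_below (cols_belowS Qj))) mulnDl addnA.
by rewrite free_count_levels.
Qed.

Lemma exprB_card (v : F) (j : 'I_n) Q : rook_placement m Q -> cols_below j Q ->
  v ^+ (j * m) = v ^+ ((j - #|Q|) * m) * v ^+ (#|Q| * m).
Proof. by move=> pQ Qj; rewrite -exprD -mulnDl subnK ?(card_cols_below pQ Qj). Qed.

(** Let k be the number of rooks, N = f - km the number of free cells in the f cells of full levels,
    and y = x - (j-k)m. The empty column gives q^(N+rho) [y], a rook in a full level gives q^rho p^y
    [N], and q^N [y] + p^y [N] = [y + N], where y + N = x + f - jm is free of k. *)
Lemma weight_step_free (j : 'I_n) Q (L := (b j %/ m)%N) :
  rook_placement m Q -> cols_below j Q -> ~~ occupied m Q L ->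
  weight j.+1 Q
    + \sum_(c | (col c == j) && (free m Q (row c) && (row c < floorm m (b j))%N))
        weight j.+1 (c |: Q)
  = q ^+ rhom m (b j) * [x + (floorm m (b j))%:R - (j * m)%:R] * weight j Q.
Proof.
move=> pQ Qj QL; have [Nf Nb] := free_counts pQ Qj.
rewrite sum_weight_rook_col ?leq_divM // weight_empty_col // Nb.
rewrite -/L QL mul1n addKn exprD bracketBn bracketDBn.
rewrite -/L (negPf QL) mul0n addn0 in Nf.
move: Nf; move: (free_count _ _) => N Nf.
rewrite -Nf !exprD !(exprB_card _ pQ Qj).
(* The powers become independent nonzero unknowns, so that only a rational identity is left. *)
move: (weight j Q) (pX_neq0 ((j - #|Q|) * m)) (pX_neq0 (#|Q| * m)).
move: (qX_neq0 ((j - #|Q|) * m)) (qX_neq0 (#|Q| * m)).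
move: (p ^+ ((j - #|Q|) * m)) (p ^+ (#|Q| * m)) (q ^+ ((j - #|Q|) * m)) (q ^+ (#|Q| * m)).
move=> pd pt qd qt qd0 qt0 w pd0 pt0.
by field; rewrite pq_neq0 pd0 pt0 qd0 qt0.
Qed.

(** With the same N and y, subtracting the rooks in full levels from all rooks of the column leaves
    p^y (p^(N+rho) - q^(N+rho)) - p^y (p^N - q^N) q^rho = p^(y+N) (p^rho - q^rho), up to division by
    p - q. *)
Lemma weight_step_partial (j : 'I_n) Q (L := (b j %/ m)%N) :
  rook_placement m Q -> cols_below j Q -> ~~ occupied m Q L ->
  \sum_(c | (col c == j) && (free m Q (row c) && ~~ (row c < floorm m (b j))%N))
      weight j.+1 (c |: Q)
  = pw (x + (floorm m (b j))%:R - (j * m)%:R) * [(rhom m (b j))%:R] * weight j Q.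
Proof.
move=> pQ Qj QL; have [Nf Nb] := free_counts pQ Qj.
have := sum_weight_rook_col pQ Qj (leqnn (b j)).
rewrite (bigID (fun c : cell b => (row c < floorm m (b j))%N)) /=.
rewrite (eq_bigl (fun c : cell b => (col c == j)
   && (free m Q (row c) && (row c < floorm m (b j))%N))); last first.
  move=> c; rewrite -!andbA; case: eqP => //= cj; congr (_ && _).
  by rewrite -cj ltn_ord.
rewrite [X in _ + X](eq_bigl (fun c : cell b => (col c == j)
   && (free m Q (row c) && ~~ (row c < floorm m (b j))%N))); last first.
  move=> c; rewrite -!andbA; case: eqP => //= cj; congr (_ && _).
  by rewrite -cj ltn_ord.
rewrite sum_weight_rook_col ?leq_divM // subnn mulr1 addrC.
move=> /(canRL (addrK _)) ->; rewrite bracket_nat.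
rewrite (is_powerBn p_neq0 hpw) (is_powerD hpw) (is_power_nat p_neq0 hpw).
rewrite Nb -/L QL mul1n addKn !exprD.
rewrite -/L (negPf QL) mul0n addn0 in Nf.
move: Nf; move: (free_count _ _) => N Nf.
rewrite -Nf !exprD !(exprB_card _ pQ Qj).
move: (weight j Q) (pX_neq0 ((j - #|Q|) * m)) (pX_neq0 (#|Q| * m)).
move: (qX_neq0 ((j - #|Q|) * m)) (qX_neq0 (#|Q| * m)).
move: (p ^+ ((j - #|Q|) * m)) (p ^+ (#|Q| * m)) (q ^+ ((j - #|Q|) * m)) (q ^+ (#|Q| * m)).
move=> pd pt qd qt qd0 qt0 w pd0 pt0.
by field; rewrite pq_neq0 pd0 pt0.
Qed.

(** The rook in the partial level takes nothing from the full levels, so now N = f + m - km, and the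
    partial level has no free cell. The identity of the free case applies with f + m for f and rho =
    0. *)
Lemma weight_step_occupied (j : 'I_n) Q (L := (b j %/ m)%N) :
  rook_placement m Q -> cols_below j Q -> occupied m Q L ->
  weight j.+1 Q
    + \sum_(c | (col c == j) && free m Q (row c)) weight j.+1 (c |: Q)
  = [x + (floorm m (b j) + m)%:R - (j * m)%:R] * weight j Q.
Proof.
move=> pQ Qj QL; have [Nf Nb] := free_counts pQ Qj.
rewrite (eq_bigl (fun c : cell b => (col c == j)
   && (free m Q (row c) && (row c < b j)%N))); last first.
  by move=> c; case: eqP => //= cj; rewrite -cj ltn_ord andbT.
rewrite sum_weight_rook_col // weight_empty_col // subnn mulr1.
rewrite -/L QL mul0n addn0 in Nb; rewrite -/L QL mul1n -Nb in Nf.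
rewrite bracketBn bracketDBn.
move: Nf; move: (free_count _ _) => N Nf.
rewrite -Nf !exprD !(exprB_card _ pQ Qj).
move: (weight j Q) (pX_neq0 ((j - #|Q|) * m)) (pX_neq0 (#|Q| * m)).
move: (qX_neq0 ((j - #|Q|) * m)) (qX_neq0 (#|Q| * m)).
move: (p ^+ ((j - #|Q|) * m)) (p ^+ (#|Q| * m)) (q ^+ ((j - #|Q|) * m)) (q ^+ (#|Q| * m)).
move=> pd pt qd qt qd0 qt0 w pd0 pt0.
by field; rewrite pq_neq0 pd0 pt0 qd0 qt0.
Qed.

(** * Recurrences for the sums A and O *)

Lemma level_partial (j : 'I_n) c : col c = j ->
  (level m c == b j %/ m)%N = ~~ (row c < floorm m (b j))%N.
Proof.
move=> cj; rewrite /floorm -ltn_divLR // -/(level m c) -leqNgt eqn_leq.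
have -> // : (level m c <= b j %/ m)%N.
by apply: leq_div2r; rewrite -cj ltnW // ltn_ord.
Qed.

(** [free_sum] and [occupied_sum] are A and O. The level [L] is a parameter because the same
    placements are split anew, by a higher level, when a zone begins. *)
Definition free_sum k L : F :=
  \sum_(Q | rook_placement m Q && cols_below k Q)
     if occupied m Q L then 0 else weight k Q.

Definition occupied_sum k L : F :=
  \sum_(Q | rook_placement m Q && cols_below k Q)
     if occupied m Q L then weight k Q else 0.

Definition total_sum k : F :=
  \sum_(Q | rook_placement m Q && cols_below k Q) weight k Q.

Lemma total_sumE k L : total_sum k = free_sum k L + occupied_sum k L.
Proof.
rewrite -big_split; apply: eq_bigr => Q _ /=.
by case: occupied; rewrite ?add0r ?addr0.
Qed.

Lemma free_sum_step (j : 'I_n) (L := (b j %/ m)%N) :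
  free_sum j.+1 L
  = q ^+ rhom m (b j) * [x + (floorm m (b j))%:R - (j * m)%:R] * free_sum j L.
Proof.
rewrite /free_sum big_placement_recr mulr_sumr; apply: eq_bigr => Q /andP[pQ Qj].
case: ifPn => QL.
  (* A rook in the partial level stays there in every extension, so both sides vanish. *)
  by rewrite mulr0 big1 ?addr0 // => c _; rewrite occupiedU QL orbT.
rewrite -weight_step_free //; congr (_ + _).
rewrite big_mkcond [RHS]big_mkcond; apply: eq_bigr => c _ /=.
case: (col c =P j) => //= cj; rewrite occupiedU (negPf QL) orbF (level_partial cj).
by rewrite /free -/(level m c); case: occupied => //=; case: ltnP.
Qed.

Lemma occupied_sum_step (j : 'I_n) (L := (b j %/ m)%N) :
  occupied_sum j.+1 L
  = pw (x + (floorm m (b j))%:R - (j * m)%:R) * [(rhom m (b j))%:R] * free_sum j L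
    + [x + (floorm m (b j) + m)%:R - (j * m)%:R] * occupied_sum j L.
Proof.
rewrite /occupied_sum big_placement_recr !mulr_sumr -big_split.
apply: eq_bigr => Q /andP[pQ Qj] /=; case: ifPn => QL.
  rewrite mulr0 add0r -weight_step_occupied //; congr (_ + _).
  by apply: eq_bigr => c _; rewrite occupiedU QL orbT.
rewrite mulr0 addr0 add0r -weight_step_partial //.
rewrite big_mkcond [RHS]big_mkcond; apply: eq_bigr => c _ /=.
case: (col c =P j) => //= cj; rewrite occupiedU (negPf QL) orbF (level_partial cj).
by rewrite /free -/(level m c); case: occupied => //=; case: ltnP.
Qed.

(** Makes O start at 0 in a new zone: no earlier column reaches its partial level. *)
Lemma occupied_sum_new (j : 'I_n) L : (b j %/ m < L)%N -> occupied_sum j.+1 L = 0.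
Proof.
move=> jL; rewrite /occupied_sum big1 // => Q /andP[_ Qj].
case: ifP => // /existsP[c /andP[cQ /eqP cL]].
by have := level_cols_below Qj cQ; rewrite cL leqNgt jL.
Qed.

Lemma cols_below0 Q : cols_below 0 Q = (Q == set0).
Proof.
apply/cols_belowP/eqP => [Q0|->]; last by move=> c; rewrite inE.
by apply/setP => c; rewrite inE; apply/negP => /Q0.
Qed.

Lemma placement0 : rook_placement m (set0 : {set cell b}).
Proof. by apply/placementP => c; rewrite inE. Qed.

Lemma occupied0 l : occupied m (set0 : {set cell b}) l = false.
Proof. by apply/existsP => -[c]; rewrite inE. Qed.

Lemma sum_cols_below0 (G : {set cell b} -> F) :
  \sum_(Q | rook_placement m Q && cols_below 0 Q) G Q = G set0.
Proof.
apply: big_pred1 => Q /=; rewrite cols_below0 andbC.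
by case: eqP => //= ->; rewrite placement0.
Qed.

Lemma weight0 : weight 0 set0 = 1.
Proof.
rewrite /weight /colsum [\prod_(d | _) _]big_pred0 // big_set0 cards0 mul0n !expr0 bin_small //.
by rewrite muln0 /falling big_ord0 divr1 !mulr1.
Qed.

(** * Zones, and the recurrences solved along a zone *)

Lemma mzoneE (j : 'I_n) : mzone m b j = [set i | b i %/ m == b j %/ m]%N.
Proof.
(* The fibre [Z i] is an interval because [b] is monotone, and it contains every admissible set
   through [i]; hence the maximal admissible sets are exactly the fibres. *)
pose Z i := [set l | b l %/ m == b i %/ m]%N : {set 'I_n}.
pose good (y : {set 'I_n}) := is_interval y && floor_constant m b y.
have eqf k l : (floorm m k == floorm m l) = (k %/ m == l %/ m)%N.
  by rewrite /floorm eqn_pmul2r.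
have goodZ i : good (Z i).
  apply/andP; split; apply/'forall_in_'forall_in_idP => k; rewrite inE => /eqP ki l;
    rewrite inE => /eqP li; last by rewrite eqf ki li.
  apply/forallP => h; apply/implyP => /andP[kh hl]; rewrite inE eqn_leq.
  by rewrite -{1}li -ki !leq_div2r // b_ferrers.
have subZ y i : good y -> i \in y -> y \subset Z i.
  move=> /andP[_ /'forall_in_'forall_in_idP yc] iy; apply/subsetP => l ly.
  by rewrite inE -eqf yc.
have zoneE z i : z \in mzones m b -> i \in z -> z = Z i.
  by rewrite inE => /maxsetP[gz zmax] iz; rewrite (zmax _ (goodZ i)) ?subZ.
have jZ : j \in Z j by rewrite inE.
apply: def_pblock => //.
  apply/trivIsetP => y z yP zP; apply: contraR => /pred0Pn[i /andP[/= iy iz]].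
  by rewrite (zoneE _ _ yP iy) (zoneE _ _ zP iz).
rewrite inE; apply/maxsetP; split=> [|y gy Zy]; first exact: goodZ.
by apply/eqP; rewrite eqEsubset Zy subZ // (subsetP Zy).
Qed.

(** Ordinals start at 0: [zone_rho_upto m b i] excludes column [i] itself and is rho_{i-1,m}(z) in
    the numbering from 1, just as [i * m] is (i-1)m. *)
Definition zone_factor (j : 'I_n) : F :=
  if last_in_zone m b j then
    q ^+ zone_rho m b (mzone m b j) * [x + (floorm m (b j))%:R - (j * m)%:R]
    + \sum_(i in mzone m b j)
        pw (x + (floorm m (b i))%:R - (i * m)%:R)
          * q ^+ zone_rho_upto m b i (mzone m b j) * [(rhom m (b i))%:R]
  else [x + (floorm m (b j))%:R - (j * m)%:R].

Definition partial_sum (k : nat) (j : 'I_n) : F :=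
  \sum_(i in mzone m b j | (i < k)%N)
    pw (x + (floorm m (b i))%:R - (i * m)%:R)
      * q ^+ zone_rho_upto m b i (mzone m b j) * [(rhom m (b i))%:R].

(* The factor with [m] added is the bracket of the previous column: it is what
   replaces the last factor of the zone once its partial level is occupied. *)
Definition zone_invariant (j : 'I_n) : Prop :=
  free_sum j (b j %/ m)
    = (\prod_(i < n | (i < j)%N) zone_factor i)
      * q ^+ zone_rho_upto m b j (mzone m b j)
  /\ [x + (floorm m (b j) + m)%:R - (j * m)%:R] * occupied_sum j (b j %/ m)
    = (\prod_(i < n | (i < j)%N) zone_factor i) * partial_sum j j.

Lemma ord_ltS (V : Type) (idx : V) (op : Monoid.com_law idx) (z : {set 'I_n})
    (f : 'I_n -> V) (j : 'I_n) : j \in z ->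
  \big[op/idx]_(i in z | (i < j.+1)%N) f i
  = op (\big[op/idx]_(i in z | (i < j)%N) f i) (f j).
Proof.
move=> jz; rewrite (bigD1 j) ?jz ?ltnSn //= Monoid.mulmC; congr (op _ _).
apply: eq_bigl => i; rewrite -andbA; congr (_ && _).
by rewrite ltnS andbC -val_eqE -ltn_neqAle.
Qed.

Lemma mem_mzone (j : 'I_n) : j \in mzone m b j.
Proof. by rewrite mzoneE inE. Qed.

Lemma zone_rho_uptoS (j : 'I_n) :
  zone_rho_upto m b j.+1 (mzone m b j)
  = (zone_rho_upto m b j (mzone m b j) + rhom m (b j))%N.
Proof. exact: (ord_ltS addn (fun i => rhom m (b i)) (mem_mzone j)). Qed.

Lemma partial_sumS (j : 'I_n) :
  partial_sum j.+1 j = partial_sum j j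
    + pw (x + (floorm m (b j))%:R - (j * m)%:R)
      * q ^+ zone_rho_upto m b j (mzone m b j) * [(rhom m (b j))%:R].
Proof. exact: (ord_ltS +%R _ (mem_mzone j)). Qed.

(** The bracket in the second half of the invariant is the coefficient of O in its recurrence, so it
    can be substituted whole. The conclusion keeps the zone and level of [j], because column [j] may
    be the last of its zone. *)
Lemma zone_invariant_step (j : 'I_n) : zone_invariant j ->
  free_sum j.+1 (b j %/ m)
    = (\prod_(i < n | (i < j)%N) zone_factor i)
      * q ^+ zone_rho_upto m b j.+1 (mzone m b j)
      * [x + (floorm m (b j))%:R - (j * m)%:R]
  /\ occupied_sum j.+1 (b j %/ m)
    = (\prod_(i < n | (i < j)%N) zone_factor i) * partial_sum j.+1 j.
Proof.
move=> [fj oj]; rewrite free_sum_step occupied_sum_step oj fj.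
rewrite zone_rho_uptoS partial_sumS exprD.
move: (\prod_(i < n | _) _) (partial_sum j j) (pw _) [_ - _] [_%:R].
move: (q ^+ zone_rho_upto _ _ _ _) (q ^+ rhom _ _) => s t u v y z w.
by split; ring.
Qed.

Lemma zone_factor_last (j : 'I_n) : last_in_zone m b j ->
  zone_factor j = q ^+ zone_rho_upto m b j.+1 (mzone m b j)
      * [x + (floorm m (b j))%:R - (j * m)%:R] + partial_sum j.+1 j.
Proof.
move=> jl; rewrite /zone_factor jl; move/'forall_in_idP: jl => jl.
have zj (i : 'I_n) : (i \in mzone m b j) && (i < j.+1)%N = (i \in mzone m b j).
  by rewrite ltnS; case: (boolP (i \in _)) => // /jl.
congr (q ^+ _ * _ + _); first by rewrite /zone_rho_upto (eq_bigl _ _ zj).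
by rewrite /partial_sum (eq_bigl _ _ zj).
Qed.

Lemma prod_zone_factorS (j : 'I_n) :
  \prod_(i < n | (i < j.+1)%N) zone_factor i
  = (\prod_(i < n | (i < j)%N) zone_factor i) * zone_factor j.
Proof.
have := ord_ltS *%R zone_factor (in_setT j).
by under eq_bigl do rewrite inE /=; under [in RHS]eq_bigl do rewrite inE /=.
Qed.

Lemma total_sum_last (j : 'I_n) : zone_invariant j -> last_in_zone m b j ->
  total_sum j.+1 = \prod_(i < n | (i < j.+1)%N) zone_factor i.
Proof.
move=> /zone_invariant_step[fj oj] jl.
by rewrite (total_sumE _ (b j %/ m)) fj oj prod_zone_factorS zone_factor_last //
  mulrDr mulrA.
Qed.

(** No column of the zone precedes [j], so its truncated sums are empty; as O is 0, A is the whole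
    total. *)
Lemma zone_invariant_start (j : 'I_n) :
  (forall i : 'I_n, (i < j)%N -> i \notin mzone m b j) ->
  total_sum j = \prod_(i < n | (i < j)%N) zone_factor i ->
  occupied_sum j (b j %/ m) = 0 -> zone_invariant j.
Proof.
move=> jfirst; rewrite (total_sumE _ (b j %/ m)) => fj oj; split.
  rewrite -fj oj addr0 /zone_rho_upto big_pred0 ?mulr1 // => i.
  by apply/negP => /andP[iz /jfirst]; rewrite iz.
rewrite oj mulr0 [partial_sum j j]big_pred0 ?mulr0 // => i.
by apply/negP => /andP[iz /jfirst]; rewrite iz.
Qed.

Lemma zone_invariant0 (j : 'I_n) : j = 0%N :> nat -> zone_invariant j.
Proof.
move=> j0; apply: zone_invariant_start; rewrite j0 => //.
  by rewrite /total_sum sum_cols_below0 weight0 big_pred0.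
by rewrite /occupied_sum sum_cols_below0 occupied0.
Qed.

Lemma zone_invariantS (i j : 'I_n) : j = i.+1 :> nat ->
  zone_invariant i -> zone_invariant j.
Proof.
move=> ji Hi; have [fi oi] := zone_invariant_step Hi.
have ij : (b i %/ m <= b j %/ m)%N by rewrite leq_div2r // b_ferrers // ji.
(* If the levels differ, [i] closes its zone and [j] opens the next; otherwise both lie in one
   zone. *)
have [Lij|Lij] := eqVneq (b i %/ m)%N (b j %/ m)%N; last first.
  apply: zone_invariant_start => [l||].
  - rewrite ji ltnS => li; rewrite mzoneE inE neq_ltn; apply/orP; left.
    by apply: (@leq_ltn_trans (b i %/ m)); rewrite ?leq_div2r ?b_ferrers // ltn_neqAle Lij.
  - rewrite ji; apply: total_sum_last Hi _; apply/'forall_in_idP => l.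
    rewrite mzoneE inE => /eqP li; rewrite leqNgt -ji; apply/negP => jl.
    move: (leq_div2r m (b_ferrers jl)); rewrite li => jl'.
    by case/eqP: Lij; apply/eqP; rewrite eqn_leq ij jl'.
  - by rewrite ji; apply: occupied_sum_new; rewrite ltn_neqAle Lij.
have zE : mzone m b i = mzone m b j by rewrite !mzoneE Lij.
have fE : floorm m (b i) = floorm m (b j) by rewrite /floorm Lij.
have factor_i : zone_factor i = [x + (floorm m (b i))%:R - (i * m)%:R].
  rewrite /zone_factor ifN //; apply/negP => /'forall_in_idP/(_ j).
  by rewrite zE mem_mzone ji ltnn => /(_ isT).
rewrite /zone_invariant /partial_sum -Lij -zE ji fi oi prod_zone_factorS factor_i.
split; first by rewrite mulrAC.
(* Here f + m - (i+1)m = f - im: the bracket required at [j] is the factor of column [i]. *)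
by rewrite -fE mulSn !natrD addrA opprD addrA addrK mulrCA mulrA.
Qed.

Lemma total_sum_full : total_sum n = \prod_j zone_factor j.
Proof.
have inv k (j : 'I_n) : j = k :> nat -> zone_invariant j.
  elim: k j => [|k IHk] j jk; first exact: zone_invariant0.
  have kn : (k < n)%N by rewrite ltnW // -jk ltn_ord.
  exact: (@zone_invariantS (Ordinal kn)) (IHk _ _).
(* Without columns there is no last column at which to close a zone. *)
have [n0|n_gt0] := posnP n.
  have -> : total_sum n = total_sum 0 by congr total_sum.
  rewrite /total_sum sum_cols_below0 weight0 big_pred0 // => j.
  by have := leq_ltn_trans (leq0n j) (ltn_ord j); rewrite n0.
have lt_n : (n.-1 < n)%N by rewrite prednK.
have jl : last_in_zone m b (Ordinal lt_n).
  by apply/'forall_in_idP => i _; rewrite /= -ltnS prednK ?ltn_ord.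
rewrite -[X in total_sum X](prednK n_gt0).
rewrite (total_sum_last (inv _ (Ordinal lt_n) erefl) jl).
by apply: eq_bigl => i; rewrite /= prednK // ltn_ord.
Qed.

End Weights.

(** * The product formula, by grouping placements by their number of rooks *)

Theorem theorem3p3 (F : fieldType) (E : pzRingType) (p q : F)
    (hp : p != 0) (hq : q != 0) (hpq : p != q)
    (pw qw : E -> F) (hpw : is_power p pw) (hqw : is_power q qw)
    (m n : nat) (hm : (0 < m)%N) (b : 'I_n -> nat) (hb : ferrers b) (x : E) :
  \sum_(0 <= k < n.+1)
     pw (x *+ k + (m * 'C(k.+1, 2))%:R) * rook_number m b p q k
       * falling p q pw qw m (n - k) x
  = \prod_(j < n)
      if last_in_zone m b j then
        q ^+ zone_rho m b (mzone m b j)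
          * bracket p q pw qw (x + (floorm m (b j))%:R - (j * m)%:R)
        + \sum_(i in mzone m b j)
            pw (x + (floorm m (b i))%:R - (i * m)%:R)
              * q ^+ zone_rho_upto m b i (mzone m b j)
              * bracket p q pw qw (rhom m (b i))%:R
      else bracket p q pw qw (x + (floorm m (b j))%:R - (j * m)%:R).
Proof.
rewrite -[RHS](total_sum_full hp hq hpq hpw hqw hm hb).
have below_n Q : @cols_below n b n Q by apply/cols_belowP => c _; exact: ltn_ord.
rewrite /total_sum big_mkord.
(* [inord] loses nothing here, since a placement has at most [n] rooks. *)
rewrite (partition_big (fun Q : {set cell b} => inord #|Q| : 'I_n.+1) xpredT) //=.
apply: eq_bigr => k _; rewrite /rook_number mulr_sumr mulr_suml.
have card_lt (Q : {set cell b}) : rook_placement m Q -> (#|Q| < n.+1)%N.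
  by move=> pQ; rewrite ltnS (card_cols_below pQ).
apply: eq_big => Q.
  rewrite below_n andbT; case: (boolP (rook_placement m Q)) => //= pQ.
  by rewrite -val_eqE /= inordK // card_lt.
move=> /andP[pQ /eqP <-].
(* For [k = n] the product runs over all cells of the board, so it collects the full statistics of
   the placement. *)
rewrite /weight (eq_bigl xpredT) => [|d]; last exact: ltn_ord.
rewrite prod_cell_wt expfzDr // -exprnN -exprnP.
rewrite (is_powerD hpw) (is_powerMn hp hpw) (is_power_nat hp hpw).
move: (falling _ _ _ _ _ _ _) (p ^- _) (p ^+ beta m Q) (q ^+ _) => u v y z.
by move: (p ^+ _) => w; ring.
Qed.
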